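(* Let $n_X,n_Y,n_B,n_A$ be positive integers and let $\mathbf q=[q(b|xy)]\in\mathrm{NS}^{\mathrm A}(n_X;n_Y,n_B)_{n_A}$. For $y\in[n_Y]$ let $\mathbf q_y$ be the behavior of the scenario $(n_X;1,n_B)$ defined by $q_y(b|x):=q(b|xy)$. Then $\mathbf q\notin\mathrm{NS}^{\mathrm{NA}}(n_X;n_Y,n_B)_{n_A}$ if and only if there exists an input $y'\in[n_Y]$ such that $\mathbf q_{y'}\in\mathrm{NS}^{\mathrm A}(n_X;1,n_B)_{n_A}$ but $\mathbf q_{y'}\notin\mathrm{NS}^{\mathrm{NA}}(n_X;1,n_B)_{n_A}$.
   Context: For a positive integer $n$, $[n]:=\{0,1,\dots,n-1\}$. Behavior: a behavior of the prepare-and-measure (PM) scenario $(n_X;n_Y,n_B)$ is a family $\mathbf q=[q(b|xy)]$ of real numbers, $b\in[n_B]$, $x\in[n_X]$, $y\in[n_Y]$, with $q(b|xy)\ge 0$ and $\sum_b q(b|xy)=1$ for all $x,y$. When $n_Y=1$ the index $y$ is omitted. Non-signaling (NS) box: for finite input and output sets, a bipartite NS box is a family of conditional probability distributions $p(\alpha\beta|\xi\eta)$ (Alice: input $\xi$, output $\alpha$; Bob: input $\eta$, output $\beta$) such that $\sum_\beta p(\alpha\beta|\xi\eta)$ does not depend on $\eta$ and $\sum_\alpha p(\alpha\beta|\xi\eta)$ does not depend on $\xi$. Non-adaptive NS-assisted set: $\mathrm{NS}^{\mathrm{NA}}(n_X;n_Y,n_B)_{n_A}$ is the set of behaviors of $(n_X;n_Y,n_B)$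 of the form $q(b|xy)=\sum_{a=0}^{n_A-1}\sum_\beta p(a\beta|xy)\,p(b|a\beta)$, where $p(a\beta|xy)$ is a bipartite NS box (Alice: input $x\in[n_X]$, output $a\in[n_A]$; Bob: input $y\in[n_Y]$, output $\beta$ in some finite set of arbitrary size) and $p(\cdot|a\beta)$ is a conditional probability distribution on $[n_B]$. Adaptive NS-assisted set: $\mathrm{NS}^{\mathrm A}(n_X;n_Y,n_B)_{n_A}$ is the set of behaviors of $(n_X;n_Y,n_B)$ of the form $q(b|xy)=\sum_{a=0}^{n_A-1}p(ab|x,(y,z=a))$, where $p(ab|x,(y,z))$ is a bipartite NS box (Alice: input $x\in[n_X]$, output $a\in[n_A]$; Bob: input the pair $(y,z)\in[n_Y]\times[n_A]$, output $b\in[n_B]$). *)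

(* Defs.v *)
(** MathComp (algebra) together with the real numbers of MathComp-Analysis. *)
From mathcomp Require Import all_boot all_order all_algebra.
From mathcomp Require Import reals.

Set Implicit Arguments.
Unset Strict Implicit.
Unset Printing Implicit Defensive.

Import Order.TTheory GRing.Theory Num.Theory.
Local Open Scope ring_scope.

(** [p o i] stands for p(o|i): outputs come before inputs, here and below. *)
Definition cond_distr (R : realType) (O I : finType) (p : O -> I -> R) : Prop :=
  (forall o i, 0 <= p o i) /\ (forall i, \sum_o p o i = 1).

(** [q b x y] stands for q(b|xy). When [nY = 1] the input [y] ranges over the
    one-element type ['I_1]. *)
Definition pm_family (R : realType) (nX nY nB : nat) : Type :=
  'I_nB -> 'I_nX -> 'I_nY -> R.

Definition is_behavior (R : realType) (nX nY nB : nat)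
    (q : pm_family R nX nY nB) : Prop :=
  (forall b x y, 0 <= q b x y) /\ (forall x y, \sum_b q b x y = 1).

(** [p a b x y] stands for p(ab|xy). *)
Definition NS_box (R : realType) (OA OB IA IB : finType)
    (p : OA -> OB -> IA -> IB -> R) : Prop :=
  [/\ cond_distr (fun (ab : OA * OB) (xy : IA * IB) => p ab.1 ab.2 xy.1 xy.2),
      forall a x y y', \sum_b p a b x y = \sum_b p a b x y'
    & forall b y x x', \sum_a p a b x y = \sum_a p a b x' y].

Definition NS_nonadaptive (R : realType) (nX nY nB nA : nat)
    (q : pm_family R nX nY nB) : Prop :=
  is_behavior q /\
  exists (T : finType) (p : 'I_nA -> T -> 'I_nX -> 'I_nY -> R)
         (r : 'I_nB -> 'I_nA * T -> R),
    [/\ NS_box p, cond_distr r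
      & forall b x y, q b x y = \sum_a \sum_t p a t x y * r b (a, t)].

Definition NS_adaptive (R : realType) (nX nY nB nA : nat)
    (q : pm_family R nX nY nB) : Prop :=
  is_behavior q /\
  exists p : 'I_nA -> 'I_nB -> 'I_nX -> 'I_nY * 'I_nA -> R,
    NS_box p /\ forall b x y, q b x y = \sum_a p a b x (y, a).

Definition at_input (R : realType) (nX nY nB : nat)
    (q : pm_family R nX nY nB) (y : 'I_nY) : pm_family R nX 1 nB :=
  fun b x _ => q b x y.

(* Main.v *)
Require Import Defs.
From mathcomp Require Import all_boot all_order all_algebra.
From mathcomp Require Import reals.
From mathcomp Require Import boolp.

(** With a single input Bob's output can be sampled before the message, so each
    restricted protocol may be run with its own box; the boxes for different [y]
    glue to one non-signaling box as soon as Alice's marginal does not depend on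
    [y].  This is arranged by letting Bob's output contain a uniform shift [s] of
    Alice's output modulo [nA], which he undoes when decoding: Alice's marginal
    becomes uniform and the behavior is unchanged. *)

Set Implicit Arguments.
Unset Strict Implicit.
Unset Printing Implicit Defensive.

Import Order.TTheory GRing.Theory Num.Theory.
Local Open Scope ring_scope.

Lemma big_subl_shift (R : nmodType) (V : finZmodType) (c : V) (F : V -> R) :
  \sum_s F (c - s) = \sum_s F s.
Proof.
rewrite [RHS](reindex_inj (h := fun s => c - s)) //.
by move=> s t /addrI /oppr_inj.
Qed.

Lemma big_subr_shift (R : nmodType) (V : finZmodType) (c : V) (F : V -> R) :
  \sum_s F (s - c) = \sum_s F s.
Proof. by rewrite [RHS](reindex_inj (addIr (- c))). Qed.

(** Serves the glued box, where Bob's output carries a tag that must match his input: only the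
    summands of that one box survive. *)
Lemma sum_tag_eq (R : nmodType) (I : finType) (T : I -> finType) (i : I)
    (F : forall j, T j -> R) :
  \sum_(u : {j : I & T j}) (if tag u == i then F (tag u) (tagged u) else 0)
    = \sum_t F i t.
Proof.
rewrite -(sig_big_dep (fun=> true) (fun _ _ => true)
  (fun j t => if j == i then F j t else 0)) /=.
rewrite (bigD1 i) //= eqxx [X in _ + X]big1 ?addr0 // => j /negPf ji.
by apply: big1 => t _; rewrite ji.
Qed.

(** The successor [n.+1] makes Alice's outputs the cyclic group of integers modulo [n.+1], in which
    the shift takes place. *)
Lemma NS_nonadaptive_uniform (R : realType) (nX nY nB n : nat)
    (q : pm_family R nX nY nB) :
  NS_nonadaptive n.+1 q ->
  exists (T : finType) (p : 'I_n.+1 -> T -> 'I_nX -> 'I_nY -> R)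
         (r : 'I_nB -> 'I_n.+1 * T -> R),
    [/\ NS_box p, cond_distr r,
        forall b x y, q b x y = \sum_a \sum_t p a t x y * r b (a, t)
      & forall a x y, \sum_t p a t x y = n.+1%:R^-1].
Proof.
case=> _ [T [p [r [[[p_ge0 p_sum1] _ p_nsB] [r_ge0 r_sum1] qE]]]].
have N0 : n.+1%:R != 0 :> R by rewrite pnatr_eq0.
have total x y : \sum_a \sum_t p a t x y = 1.
  by rewrite pair_bigA -(p_sum1 (x, y)).
(* Bob's new output is a pair [u = (t, s)] with [s] uniform. Alice announces her old output plus
   [s], so the old output is [a - s]; [r'] recovers it before decoding. *)
pose p' (a : 'I_n.+1) (u : T * 'I_n.+1) x y := p (a - u.2) u.1 x y / n.+1%:R.
pose r' b (v : 'I_n.+1 * (T * 'I_n.+1)) := r b (v.1 - v.2.2, v.2.1).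
have unif a x y : \sum_u p' a u x y = n.+1%:R^-1.
  rewrite /p' -(pair_bigA _ (fun t s => p (a - s) t x y / n.+1%:R)) exchange_big.
  (* For fixed [a], the value [a - s] runs over all old outputs, so the sum is the total mass 1
     divided by [n.+1]. *)
  rewrite (big_subl_shift a (fun s => \sum_t p s t x y / n.+1%:R)).
  under eq_bigr do rewrite -mulr_suml.
  by rewrite -mulr_suml total mul1r.
exists (T * 'I_n.+1)%type, p', r'; split=> //.
- split=> [|a x y y'|b y x x'].
  + split=> [[a u] [x y]|[x y]] /=.
      by rewrite /p' divr_ge0 ?ler0n // (p_ge0 (_, _) (x, y)).
    rewrite -(pair_bigA _ (fun a u => p' a u x y)) /=.
    under eq_bigr do rewrite unif.
    by rewrite sumr_const card_ord -[_^-1 *+ _]mulr_natr mulVf.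
  + by rewrite !unif.
  (* At a fixed shift [b.2], Bob's marginal is his old one divided by [n.+1], which does not depend
     on [x]. *)
  + rewrite /p' -!mulr_suml.
    rewrite !(big_subr_shift b.2 (fun a => p a b.1 _ y)).
    by rewrite (p_nsB b.1 y x x').
- by split=> [o i|i]; [exact: r_ge0 | exact: r_sum1].
- move=> b x y; rewrite qE.
  (* Each shift contributes the same amount, [q b x y / n.+1%:R], and there are [n.+1] shifts. *)
  transitivity (\sum_(s < n.+1) \sum_a \sum_t
      p (a - s) t x y / n.+1%:R * r b (a - s, t)).
    under [RHS]eq_bigr => s _.
      rewrite (big_subr_shift s
        (fun a => \sum_t p a t x y / n.+1%:R * r b (a, t))).
      over.
    rewrite sumr_const card_ord -[(\sum_a _) *+ _]mulr_natr mulr_suml.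
    apply: eq_bigr => a _; rewrite mulr_suml; apply: eq_bigr => t _.
    by rewrite mulrAC divfK.
  rewrite exchange_big; apply: eq_bigr => a _.
  rewrite exchange_big pair_bigA; exact: eq_bigr.
Qed.

Lemma NS_adaptive_at_input (R : realType) (nX nY nB nA : nat)
    (q : pm_family R nX nY nB) (y : 'I_nY) :
  NS_adaptive nA q -> NS_adaptive nA (at_input q y).
Proof.
case=> -[q_ge0 q_sum1] [p [[[p_ge0 p_sum1] p_nsA p_nsB] qE]].
split; first by split=> [b x o|x o]; [exact: q_ge0 | exact: q_sum1].
exists (fun a b x yz => p a b x (y, yz.2)); split=> [|b x o]; last exact: qE.
split=> [|a x yz yz'|b yz x x']; [|exact: p_nsA|exact: p_nsB].
split=> [ab xyz|xyz]; first exact: (p_ge0 ab (xyz.1, (y, xyz.2.2))).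
exact: (p_sum1 (xyz.1, (y, xyz.2.2))).
Qed.

Lemma NS_nonadaptive_at_input (R : realType) (nX nY nB nA : nat)
    (q : pm_family R nX nY nB) (y : 'I_nY) :
  NS_nonadaptive nA q -> NS_nonadaptive nA (at_input q y).
Proof.
case=> -[q_ge0 q_sum1] [T [p [r [[[p_ge0 p_sum1] p_nsA p_nsB] r_distr qE]]]].
split; first by split=> [b x o|x o]; [exact: q_ge0 | exact: q_sum1].
exists T, (fun a t x _ => p a t x y), r; split=> // [|b x o]; last exact: qE.
split=> //.
split=> [at_ xy|xy]; first exact: (p_ge0 at_ (xy.1, y)).
exact: (p_sum1 (xy.1, y)).
Qed.

(** Bob's input [y] selects the box to run. The decoder does not see [y], so Bob's output records it
    as the tag of a dependent pair, which also lets the output type [T y] vary with [y]. *)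
Lemma NS_nonadaptive_glue (R : realType) (nX nY nB n : nat)
    (q : pm_family R nX nY nB) :
  is_behavior q -> (forall y, NS_nonadaptive n.+1 (at_input q y)) ->
  NS_nonadaptive n.+1 q.
Proof.
move=> q_behavior q_na; split=> //.
pose T y := sval (cid (NS_nonadaptive_uniform (q_na y))).
pose TP y := svalP (cid (NS_nonadaptive_uniform (q_na y))).
pose p y := sval (cid (TP y)).
pose pP y := svalP (cid (TP y)).
pose r y := sval (cid (pP y)).
have p_box y : NS_box (p y) by case: (svalP (cid (pP y))).
have r_distr y : cond_distr (r y) by case: (svalP (cid (pP y))).
have qE b x y : q b x y = \sum_a \sum_t p y a t x ord0 * r y b (a, t).
  by have [_ _ qyE _] := svalP (cid (pP y)); exact: (qyE b x ord0).
have p_unif y a x : \sum_t p y a t x ord0 = n.+1%:R^-1.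
  by have [_ _ _] := svalP (cid (pP y)); apply.
pose p' a (u : {y : 'I_nY & T y}) x y :=
  if tag u == y then p (tag u) a (tagged u) x ord0 else 0.
pose r' b (v : 'I_n.+1 * {y : 'I_nY & T y}) :=
  r (tag v.2) b (v.1, tagged v.2).
have unif a x y : \sum_u p' a u x y = n.+1%:R^-1.
  by rewrite (sum_tag_eq y (fun z t => p z a t x ord0)).
exists {y : 'I_nY & T y}, p', r'; split.
- split=> [|a x y y'|b y x x'].
  + split=> [[a u] [x y]|[x y]] /=.
      rewrite /p'; case: ifP => // _.
      by have [[p_ge0 _] _ _] := p_box (tag u); apply: (p_ge0 (_, _) (x, ord0)).
    rewrite -(pair_bigA _ (fun a u => p' a u x y)) /=.
    under eq_bigr do rewrite unif.
    by rewrite sumr_const card_ord -[_^-1 *+ _]mulr_natr mulVf ?pnatr_eq0.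
  (* Different [y] involve unrelated boxes; their marginals for Alice agree only because all were
     made uniform. *)
  + by rewrite !unif.
  (* With the wrong tag both sums vanish; otherwise both belong to the single box of that tag. *)
  + rewrite /p'; case: eqP => // _.
    by have [_ _] := p_box (tag b); apply.
- split=> [b [a u]|[a u]]; first exact: (r_distr (tag u)).1.
  exact: (r_distr (tag u)).2.
- move=> b x y; rewrite qE; apply: eq_bigr => a _.
  rewrite -(sum_tag_eq y (fun z t => p z a t x ord0 * r z b (a, t))).
  by apply: eq_bigr => u _; rewrite /p' /r'; case: ifP; rewrite ?mul0r.
Qed.

Theorem corollary1 (R : realType) (nX nY nB nA : nat)
    (nX_gt0 : (0 < nX)%N) (nY_gt0 : (0 < nY)%N)
    (nB_gt0 : (0 < nB)%N) (nA_gt0 : (0 < nA)%N)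
    (q : pm_family R nX nY nB) (q_adaptive : NS_adaptive nA q) :
  ~ NS_nonadaptive nA q <->
  exists y' : 'I_nY,
    NS_adaptive nA (at_input q y') /\ ~ NS_nonadaptive nA (at_input q y').
Proof.
split=> [q_not_na|[y [_ qy_not_na]] q_na]; last first.
  exact/qy_not_na/NS_nonadaptive_at_input.
(* If no [y'] exists, every restriction is non-adaptive, since each one inherits adaptivity from
   [q]; gluing then makes [q] non-adaptive. *)
apply: contrapT => no_y; apply: q_not_na.
case: nA nA_gt0 q_adaptive no_y => // n _ q_adaptive no_y.
apply: NS_nonadaptive_glue => [|y]; first by case: q_adaptive.
apply: contrapT => qy_not_na; apply: no_y.
by exists y; split=> //; apply: NS_adaptive_at_input.
Qed.
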